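(* Let $R(q)=\dfrac{(q;q^5)_\infty(q^4;q^5)_\infty}{(q^2;q^5)_\infty(q^3;q^5)_\infty}$ and define the coefficients $A(n)$, $n\ge 0$, by the power series expansion $$\frac{1}{R^5(q)}=\sum_{n=0}^{\infty}A(n)q^n,\qquad |q|<1.$$ Then $A(0)>0$, $A(10)<0$, and $A(15)<0$.
   Context: For complex numbers $a,q$ with $|q|<1$, $(a;q)_\infty:=\prod_{k=0}^{\infty}(1-aq^k)$. The function $R(q)$ is the Rogers-Ramanujan continued fraction without its factor $q^{1/5}$, i.e. $R(q)=\cfrac{1}{1+\cfrac{q}{1+\cfrac{q^2}{1+\cfrac{q^3}{1+\cdots}}}}$, which equals the infinite product $\dfrac{(q;q^5)_\infty(q^4;q^5)_\infty}{(q^2;q^5)_\infty(q^3;q^5)_\infty}$ (a classical identity of Rogers and Ramanujan). Here $R^5(q)$ denotes $(R(q))^5$. *)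

(* Defs.v *)
From HB Require Import structures.
From mathcomp Require Import all_boot all_order all_algebra.
From mathcomp Require Import all_classical all_reals all_analysis complex.

Set Implicit Arguments.
Unset Strict Implicit.
Unset Printing Implicit Defensive.

Import Order.TTheory GRing.Theory Num.Theory numFieldNormedType.Exports.

Local Open Scope classical_set_scope.
Local Open Scope ring_scope.
Local Open Scope complex_scope.

(* The [^o] is what gives [R[i]] the topology of its norm; on this type
   [0 < z] means that [z] is real and positive. *)
Notation Cplx R := (R[i]^o).

(* Meaningful for [`|q| < 1], where the partial products converge; elsewhere
   [limn] may be a junk value. *)
Definition qpochhammer (R : realType) (a q : Cplx R) : Cplx R :=
  limn (fun n => \prod_(0 <= k < n) (1 - a * q ^+ k)).

Definition rogers_ramanujan (R : realType) (q : Cplx R) : Cplx R :=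
  (qpochhammer q (q ^+ 5) * qpochhammer (q ^+ 4) (q ^+ 5))
  / (qpochhammer (q ^+ 2) (q ^+ 5) * qpochhammer (q ^+ 3) (q ^+ 5)).

(* Main.v *)
(* Along real x -> 0+ both sides have expansions to order O(x^16): the power
   series gives the polynomial P = sum_(n < 16) A(n) x^n, and an infinite product
   agrees with its first three factors, since every omitted factor is
   1 + O(x^16). From (1/R^5) * D^5 = N^5, where D and N are the products in the
   numerator and denominator of R, uniqueness of expansions yields
   P * D^5 = N^5 modulo X^16. As D has constant term 1, this determines
   A(0), ..., A(15). *)

Require Import Defs.
From HB Require Import structures.
From mathcomp Require Import all_boot all_order all_algebra.
From mathcomp Require Import all_classical all_reals all_analysis complex.
From mathcomp Require Import ring lra zify.

Import Order.TTheory GRing.Theory Num.Theory numFieldNormedType.Exports.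

Local Open Scope classical_set_scope.
Local Open Scope ring_scope.
Local Open Scope complex_scope.

(* Real arguments suffice to identify coefficients, and there the convergence of
   the products follows from monotonicity instead of completeness of R[i]. *)
Definition expands (R : realType) (N : nat) (f : R -> R[i]) (p : {poly R[i]}) :=
  exists (C : R[i]) (r : R), 0 < r /\ forall x : R, 0 < x < r ->
    `|f x - p.[x%:C]| <= C * x%:C ^+ N.

Arguments expands {R} N f p.

(** * Expansions at 0 along the positive reals: products and uniqueness *)

Section expansions.
Context {R : realType}.
Implicit Types (f g : R -> R[i]) (p q : {poly R[i]}) (N : nat).

Lemma realC_ge0 {x : R} : 0 < x -> 0 <= x%:C.
Proof. by move=> x0; rewrite lecR ltW. Qed.

Lemma norm_horner_le p : exists C : R[i], forall x : R, 0 < x < 1 ->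
  `|p.[x%:C]| <= C.
Proof.
exists (\sum_(i < size p) `|p`_i|) => x /andP[x0 x1].
rewrite horner_coef; apply: (le_trans (ler_norm_sum _ _ _)).
apply: ler_sum => i _; rewrite normrM -[leRHS]mulr1 ler_wpM2l //.
rewrite normrX (ger0_norm (realC_ge0 x0)) -rmorphXn lecR.
by rewrite exprn_ile1 ?ltW.
Qed.

(** Write f g - p q = (f - p)(g - q) + p (g - q) + (f - p) q. The polynomials are bounded on (0, 1),
    and x^N <= 1 absorbs the second factor x^N of the first term. *)
Lemma expandsM {N f g p q} : expands N f p -> expands N g q ->
  expands N (fun x => f x * g x) (p * q).
Proof.
move=> [C [r [r0 Cf]]] [D [s [s0 Dg]]].
have [P bP] := norm_horner_le p; have [Q bQ] := norm_horner_le q.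
exists (C * D + P * D + C * Q), (Num.min 1 (Num.min r s)).
split; first by rewrite !lt_min ltr01 r0 s0.
move=> x /andP[x0]; rewrite !lt_min => /and3P[x1 xr xs].
have {}Cf := Cf x; have {}Dg := Dg x; rewrite x0 xr xs in Cf Dg.
have {}bP := bP x; have {}bQ := bQ x; rewrite x0 x1 in bP bQ.
move: {Cf Dg bP bQ}(Cf isT) (Dg isT) (bP isT) (bQ isT) => Cf Dg bP bQ.
set t := x%:C ^+ N in Cf Dg *.
have t0 : 0 <= t by rewrite exprn_ge0 ?realC_ge0.
have t1 : t <= 1 by rewrite /t -rmorphXn lecR exprn_ile1 ?ltW.
rewrite hornerM.
have -> : f x * g x - p.[x%:C] * q.[x%:C] =
  (f x - p.[x%:C]) * (g x - q.[x%:C]) + p.[x%:C] * (g x - q.[x%:C])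
  + (f x - p.[x%:C]) * q.[x%:C] by ring.
have -> : (C * D + P * D + C * Q) * t = C * D * t + P * (D * t) + C * t * Q.
  by ring.
apply: (le_trans (ler_normD _ _)); apply: lerD; last first.
  by rewrite normrM ler_pM.
apply: (le_trans (ler_normD _ _)); apply: lerD; last first.
  by rewrite normrM ler_pM.
rewrite normrM; apply: (@le_trans _ _ (C * t * (D * t))); first by rewrite ler_pM.
have -> : C * D * t = C * t * D by ring.
have Ct0 : 0 <= C * t := le_trans (normr_ge0 _) Cf.
have Dt0 : 0 <= D * t := le_trans (normr_ge0 _) Dg.
(* [D] is an arbitrary element of [R[i]]; its sign is read off from 0 <= D t, which takes t != 0. *)
have [->|tN0] := eqVneq t 0; first by rewrite !(mulr0, mul0r).
have D0 : 0 <= D by rewrite -(@pmulr_lge0 _ t) // lt_neqAle eq_sym tN0.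
by rewrite ler_wpM2l // ler_piMr.
Qed.

Lemma expands_const N (c : R[i]) : expands N (fun=> c) c%:P.
Proof.
exists 0, 1; split=> // x _.
by rewrite hornerC subrr normr0 mul0r.
Qed.

Lemma expandsX {N f p} n : expands N f p ->
  expands N (fun x => f x ^+ n) (p ^+ n).
Proof.
move=> fp; elim: n => [|n IH]; first exact: expands_const.
have -> : (fun x => f x ^+ n.+1) = (fun x => f x * f x ^+ n).
  by apply: funext => x; rewrite exprS.
by rewrite exprS; apply: expandsM.
Qed.

(** Let x tend to 0. Both |c| and [K] are real elements of [R[i]], so the argument is carried out in
    [R]. *)
Lemma le_small_eq0 (c K : R[i]) (r : R) : 0 < r ->
  (forall x : R, 0 < x < r -> `|c| <= K * x%:C) -> c = 0.
Proof.
move=> r0 cK; apply/eqP; rewrite -normr_le0 //.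
have rC x : x \is Num.real -> exists y : R, x = y%:C.
  by move=> xr; exists (complex.Re x); rewrite RRe_real.
have [a ca] := rC _ (normr_real c).
have r2 : 0 < r / 2 < r by rewrite divr_gt0 //= ltr_pdivrMr // ltr_pMr // ltr1n.
have K0 : 0 <= K.
  rewrite -(@pmulr_lge0 _ (r / 2)%:C); last by rewrite ltcR; case/andP: r2.
  exact: le_trans (normr_ge0 _) (cK _ r2).
have [k Kk] := rC _ (ger0_real K0).
rewrite ca lecR leNgt; apply/negP => a0.
rewrite Kk lecR in K0.
(* This x gives (k + 1) x < a, against a <= k x; k + 1 is positive even when k = 0. *)
pose x := Num.min (r / 2) (a / (k + 1) / 2).
have k1 : 0 < k + 1 by rewrite ltr_wpDl.
have x0 : 0 < x by rewrite lt_min !divr_gt0.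
have xr : x < r by rewrite gt_min; case/andP: r2 => _ ->.
have := cK x; rewrite x0 xr => /(_ isT).
rewrite ca Kk -rmorphM lecR leNgt => /negP; apply.
apply: (@le_lt_trans _ _ ((k + 1) * x)).
  by rewrite ler_wpM2r ?ltW // ltrDl.
rewrite mulrC -ltr_pdivlMr //.
apply: (@le_lt_trans _ _ (a / (k + 1) / 2)); first by rewrite ge_min lexx orbT.
by rewrite ltr_pdivrMr // ltr_pMr ?divr_gt0 // ltr1n.
Qed.

(** Induction on [N]: letting x tend to 0 kills the constant term, and dividing the bound by x
    lowers the exponent by one. *)
Lemma coef_eq0_of_small N p (C : R[i]) (r : R) : 0 < r ->
    (forall x : R, 0 < x < r -> `|p.[x%:C]| <= C * x%:C ^+ N) ->
  forall i, (i < N)%N -> p`_i = 0.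
Proof.
elim: N p C r => [//|N IH] p C r r0.
elim/poly_ind: p => [|p c _] pC i iN; first by rewrite coef0.
have [P bP] := norm_horner_le p.
have c0 : c = 0.
  apply: (@le_small_eq0 _ (C + P) (Num.min 1 r)); first by rewrite lt_min ltr01.
  move=> x /andP[x0]; rewrite lt_min => /andP[x1 xr].
  have := pC x; rewrite x0 xr => /(_ isT); rewrite hornerMXaddC => pcC.
  have := bP x; rewrite x0 x1 => /(_ isT) {}bP.
  have -> : c = (p.[x%:C] * x%:C + c) - p.[x%:C] * x%:C by ring.
  apply: (le_trans (ler_normB _ _)); rewrite mulrDl.
  have xC0 := realC_ge0 x0.
  have xN1 : x%:C ^+ N <= 1 by rewrite -rmorphXn lecR exprn_ile1 ?ltW.
  have C0 : 0 <= C.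
    rewrite -(@pmulr_lge0 _ (x%:C ^+ N.+1)) ?exprn_gt0 ?ltcR //.
    exact: le_trans (normr_ge0 _) pcC.
  apply: lerD.
    by apply: (le_trans pcC); rewrite exprS ler_wpM2l // ler_piMr.
  by rewrite normrM (ger0_norm xC0) ler_wpM2r.
rewrite coefD coefMX coefC c0.
case: i iN => [|i] iN /=; first by rewrite addr0.
rewrite addr0; apply: (IH p C r r0) => // x /andP[x0 xr].
have := pC x; rewrite x0 xr => /(_ isT).
rewrite hornerMXaddC c0 addr0 normrM exprSr mulrA (ger0_norm (realC_ge0 x0)).
by rewrite ler_pM2r // ltcR.
Qed.

Lemma expands_uniq {N f p q} : expands N f p -> expands N f q ->
  forall i, (i < N)%N -> p`_i = q`_i.
Proof.
move=> [C [r [r0 Cp]]] [D [s [s0 Dq]]] i iN.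
apply/eqP; rewrite -subr_eq0 -coefB; apply/eqP.
apply: (@coef_eq0_of_small N (p - q) (D + C) (Num.min r s)) => //.
  by rewrite lt_min r0.
move=> x /andP[x0]; rewrite lt_min => /andP[xr xs].
have := Cp x; have := Dq x; rewrite x0 xr xs => /(_ isT) {}Dq /(_ isT) {}Cp.
rewrite hornerD hornerN.
have -> : p.[x%:C] - q.[x%:C] = (f x - q.[x%:C]) - (f x - p.[x%:C]) by ring.
by rewrite mulrDl; apply: (le_trans (ler_normB _ _)); apply: lerD.
Qed.

End expansions.

(** * The infinite products at small real arguments *)

Section infinite_products.
Context {R : realType} (b c : nat).
Hypotheses (b0 : (0 < b)%N) (c0 : (0 < c)%N).

(** The partial products of (x^b; x^c)_oo, taken in [R] to use its order. *)
Let rprod (x : R) n := \prod_(0 <= k < n) (1 - x ^+ (b + c * k)).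

Let factor_itv {x : R} k : 0 < x < 1 -> 0 <= 1 - x ^+ (b + c * k) <= 1.
Proof.
move=> /andP[x0 x1]; rewrite subr_ge0 exprn_ile1 ?(ltW x0) ?(ltW x1) //=.
by rewrite lerBlDr lerDl exprn_ge0 ?ltW.
Qed.

Let rprod_itv {x : R} n : 0 < x < 1 -> 0 <= rprod x n <= 1.
Proof.
move=> x01; elim: n => [|n /andP[IH0 IH1]].
  by rewrite /rprod big_geq // ler01 lexx.
have /andP[f0 f1] := factor_itv n x01.
by rewrite /rprod big_nat_recr //= mulr_ge0 //= mulr_ile1.
Qed.

Let rprodS_le {x : R} n : 0 < x < 1 -> rprod x n.+1 <= rprod x n.
Proof.
move=> x01; have /andP[f0 f1] := factor_itv n x01.
have /andP[r0 _] := rprod_itv n x01.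
by rewrite /rprod big_nat_recr //= ler_piMr.
Qed.

(** The factor of index m + j lowers the product by at most x^(b + c (m + j)) <= x^(b + c m) 2^-j;
    these losses sum to 2 x^(b + c m) (1 - 2^-n). *)
Let rprod_ge {x : R} m n : 0 < x < 2^-1 ->
  rprod x m - 2 * x ^+ (b + c * m) * (1 - 2^-1 ^+ n) <= rprod x (m + n).
Proof.
move=> /andP[x0 xh].
have x01 : 0 < x < 1 by rewrite x0 (lt_trans xh) // invf_lt1 // ltr1n.
elim: n => [|n IH]; first by rewrite expr0 subrr mulr0 subr0 addn0.
have -> : rprod x (m + n.+1) = rprod x (m + n) * (1 - x ^+ (b + c * (m + n))).
  by rewrite addnS /rprod big_nat_recr.
have /andP[r0 r1] := rprod_itv (m + n) x01.
set y := x ^+ (b + c * (m + n)).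
have y0 : 0 <= y by rewrite exprn_ge0 // ltW.
have : y <= x ^+ (b + c * m) * 2^-1 ^+ n.
  rewrite /y mulnDr addnA exprD ler_wpM2l ?exprn_ge0 ?(ltW x0) //.
  apply: (@le_trans _ _ (x ^+ n)); last by rewrite lerXn2r ?nnegrE ?invr_ge0 ?ltW.
  by rewrite ler_wiXn2l ?ltW ?leq_pmull //; case/andP: x01.
have : rprod x (m + n) * y <= y by rewrite ler_piMl.
rewrite exprS; move: IH; set z := x ^+ _; set t := 2^-1 ^+ n.
set r := rprod x (m + n) => IH H1 H2; lra.
Qed.

(** The partial products decrease and are nonnegative, hence converge; [rprod_ge] passes to the
    limit as a bound uniform in x. *)
Lemma cvg_rprod {x : R} : 0 < x < 2^-1 -> exists2 l : R,
  rprod x @ \oo --> l &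
  forall m, rprod x m - 2 * x ^+ (b + c * m) <= l <= rprod x m.
Proof.
move=> xh; have x01 : 0 < x < 1.
  by case/andP: xh => -> xh; rewrite (lt_trans xh) // invf_lt1 // ltr1n.
have rdec : {homo rprod x : n m / (n <= m)%N >-> m <= n}.
  by apply/nonincreasing_seqP => n; apply: rprodS_le.
have rcvg : cvgn (rprod x).
  apply: nonincreasing_is_cvgn => //; exists 0 => _ [n _ <-].
  by case/andP: (rprod_itv n x01).
exists (limn (rprod x)) => // m; rewrite nonincreasing_cvgn_ge // andbT.
apply: limr_ge => //; exists m => // n /= mn.
have -> : n = (m + (n - m))%N by rewrite subnKC.
apply: le_trans (rprod_ge _ _ xh); rewrite lerB // ler_piMr //.
by rewrite mulr_ge0 // exprn_ge0 // ltW //; case/andP: x01.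
Qed.

Lemma cvg_realC {u : nat -> R} {l : R} : u @ \oo --> l ->
  (fun n => (u n)%:C : Cplx R) @ \oo --> (l%:C : Cplx R).
Proof.
move=> ul; apply/cvgrPdist_lt => e e0.
(* A positive element of [R[i]] is real, so it serves as an epsilon in [R]. *)
have er : (complex.Re e)%:C = e :> R[i] by rewrite RRe_real // gtr0_real.
have e0' : 0 < complex.Re e by rewrite -ltcR er.
near=> n.
have : `|l - u n| < complex.Re e.
  by near: n; move/cvgrPdist_lt: ul; apply.
rewrite -ltcR er => /le_lt_trans; apply.
by rewrite -rmorphB /= normc_def /= expr0n /= addr0 sqrtr_sqr.
Unshelve. all: by end_near.
Qed.

Lemma qpochhammer_real {x l : R} : rprod x @ \oo --> l ->
  qpochhammer (x%:C ^+ b : Cplx R) (x%:C ^+ c) = l%:C.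
Proof.
move=> /cvg_realC xl; apply: cvg_lim; first exact: norm_hausdorff.
apply: cvg_trans xl; apply: near_eq_cvg; near=> n.
rewrite /rprod rmorph_prod; apply: eq_bigr => k _.
by rewrite rmorphB rmorph1 /= rmorphXn exprD exprM.
Unshelve. all: by end_near.
Qed.

(** The bound of [cvg_rprod] at m = 0 reads l >= 1 - 2 x^b, which is positive as b >= 1 and x <
    1/2. *)
Lemma qpochhammer_neq0 {x : R} : 0 < x < 2^-1 ->
  qpochhammer (x%:C ^+ b : Cplx R) (x%:C ^+ c) != 0.
Proof.
move=> xh; have [l xl /(_ 0%N)/andP[lb _]] := cvg_rprod xh.
rewrite (qpochhammer_real xl) -(rmorph0 (real_complex R)).
rewrite (inj_eq (@complexI R)) gt_eqF //.
apply: lt_le_trans lb; rewrite /rprod big_geq // muln0 addn0 subr_gt0.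
have /andP[x0 x2] := xh.
rewrite mulrC -ltr_pdivlMr // div1r; apply: (le_lt_trans _ x2).
rewrite -[leRHS]expr1 ler_wiXn2l ?ltW //.
by rewrite (lt_trans x2) // invf_lt1 // ltr1n.
Qed.

Lemma expands_qpochhammer N m : (N <= b + c * m)%N ->
  expands N (fun x : R => qpochhammer (x%:C ^+ b : Cplx R) (x%:C ^+ c))
    (\prod_(0 <= k < m) (1 - 'X^(b + c * k))).
Proof.
move=> Nm; exists 2, 2^-1; split=> [|x xh]; first by rewrite invr_gt0.
have [l xl /(_ m)/andP[lb ub]] := cvg_rprod xh.
rewrite (qpochhammer_real xl) horner_prod.
have -> : \prod_(0 <= k < m) (1 - 'X^(b + c * k)).[x%:C] = (rprod x m)%:C.
  rewrite rmorph_prod; apply: eq_bigr => k _.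
  by rewrite hornerD hornerN hornerXn hornerC rmorphB rmorph1 rmorphXn.
have -> : `|l%:C - (rprod x m)%:C| = `|l - rprod x m|%:C.
  by rewrite -rmorphB /= normc_def /= expr0n /= addr0 sqrtr_sqr.
rewrite -rmorphXn -(rmorph_nat (real_complex R) 2) -rmorphM lecR.
rewrite ler0_norm ?subr_le0 // opprB lerBlDr addrC -lerBlDr.
apply: le_trans lb; rewrite lerB // ler_wpM2l // ler_wiXn2l //.
  by rewrite ltW //; case/andP: xh.
by case/andP: xh => _ /lt_trans/(_ _)/ltW; apply; rewrite invf_lt1 // ltr1n.
Qed.

End infinite_products.

(** * Convergent power series as expansions *)

Lemma geometric_sum_le2 {K : numFieldType} {y : K} (n : nat) :
  0 <= y <= 2^-1 -> \sum_(i < n) y ^+ i <= 2.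
Proof.
move=> /andP[y0 y2]; elim: n => [|n IH]; first by rewrite big_ord0.
rewrite big_ord_recl expr0.
under eq_bigr do rewrite exprS.
rewrite -mulr_sumr -[leRHS]/(1 + 1) lerD2l.
rewrite -[leRHS](@mulVf _ (2 : K)) ?pnatr_eq0 // ler_pM //.
by apply: sumr_ge0 => i _; rewrite exprn_ge0.
Qed.

Lemma cvg_series_bounded_terms {K : numFieldType} {V : normedModType K}
    {u : V ^nat} : cvgn (series u) -> exists M : K, forall n, `|u n| <= M.
Proof.
move=> /cvg_series_cvg_0/cvgrPdist_lt/(_ 1 ltr01)[n0 _ un0].
exists (\sum_(i < n0) `|u i| + 1) => n.
have [n0n|nn0] := leqP n0 n.
  apply: (@le_trans _ _ 1); last by rewrite lerDr sumr_ge0.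
  by have /ltW := un0 n n0n; rewrite sub0r normrN.
by rewrite (bigD1 (Ordinal nn0)) //= -addrA lerDl addr_ge0 // sumr_ge0.
Qed.

(** Convergence at 1/2 bounds the terms there by some M, so |A n| <= M 2^n. For x < 1/4 the terms
    from index N on are dominated by a geometric series of ratio 2 x <= 1/2 starting at M (2
    x)^N. *)
Lemma expands_series {R : realType} (A : nat -> Cplx R) (f : R -> Cplx R) N :
    (forall x : R, 0 < x < 1 ->
      series (fun n => A n * (x%:C : Cplx R) ^+ n) @ \oo --> f x) ->
  expands N f (\poly_(i < N) A i).
Proof.
move=> Af; pose h : R := 2^-1; have h01 : 0 < h < 1 by rewrite /h; lra.
have [M AM] : exists M : R[i], forall n, `|A n * h%:C ^+ n| <= M.
  apply: (@cvg_series_bounded_terms _ (Cplx R) (fun n => A n * (h%:C : Cplx R) ^+ n)).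
  exact: cvgP (Af _ h01).
exists (1 + M * 2 ^+ N * 2), 4^-1; split=> [|x /andP[x0 x4]]; first by rewrite invr_gt0.
have x01 : 0 < x < 1 by rewrite x0 (lt_trans x4) // invf_lt1 // ltr1n.
have xC0 : 0 < x%:C by rewrite ltcR.
(* A partial sum within x^N of the limit leaves only a finite tail to estimate; this error is the 1
   in the constant. *)
have /cvgrPdist_lt/(_ (x%:C ^+ N))[|n _ Sn] := Af _ x01; first exact: exprn_gt0.
have {Sn} := Sn (N + n)%N (leq_addl _ _).
rewrite [series _ _]/series /= (@big_cat_nat _ _ _ N) ?leq_addr //= => Sn.
rewrite horner_poly -(big_mkord xpredT (fun i => A i * x%:C ^+ i)).
set T := \sum_(N <= i < N + n) _ in Sn.
set P := \sum_(0 <= i < N) _ in Sn *.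
have -> : f x - P = (f x - (P + T)) + T by rewrite opprD addrA subrK.
rewrite mulrDl mul1r; apply: (le_trans (ler_normD _ _)).
apply: lerD; first exact: ltW.
rewrite /T -{1}[N]add0n big_addn addKn big_mkord.
have y01 : 0 <= 2 * x%:C <= 2^-1.
  rewrite mulr_ge0 ?(ltW xC0) //=.
  rewrite -(rmorph_nat (real_complex R) 2) -rmorphM -fmorphV lecR.
  by move: x4; rewrite (_ : 4 = 2 * 2) ?invfM -?natrM //; lra.
have M0 : 0 <= M := le_trans (normr_ge0 _) (AM 0%N).
apply: (@le_trans _ _ (\sum_(i < n) M * (2 * x%:C) ^+ N * (2 * x%:C) ^+ i)).
  apply: (le_trans (ler_norm_sum _ _ _)); apply: ler_sum => i _.
  rewrite -mulrA -exprD [(N + i)%N]addnC exprMn.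
  have -> : A (i + N)%N * x%:C ^+ (i + N) =
     (A (i + N)%N * h%:C ^+ (i + N)) * (2 ^+ (i + N) * x%:C ^+ (i + N)).
    rewrite -mulrA; congr (_ * _); rewrite mulrA -exprMn fmorphV rmorph_nat.
    by rewrite mulVf ?expr1n ?mul1r // pnatr_eq0.
  rewrite normrM ler_pM // ger0_norm //.
  by rewrite mulr_ge0 // exprn_ge0 // ltW.
rewrite -mulr_sumr exprMn.
have -> : M * 2 ^+ N * 2 * x%:C ^+ N = M * (2 ^+ N * x%:C ^+ N) * 2 by ring.
rewrite ler_wpM2l ?geometric_sum_le2 //.
by rewrite !mulr_ge0 // exprn_ge0 // ltW.
Qed.

(** * Computing with truncated power series *)

Section truncated_coefficients.
Context {K : nzRingType}.
Implicit Types (s : seq int) (p : {poly K}) (m : nat).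

(** Integer lists stand for power series modulo X^(size s), so that products can be evaluated by
    [vm_compute]. *)
Definition truncation s p := forall i, (i < size s)%N -> p`_i = (s`_i)%:~R.

Definition mul_one_subXn m s :=
  mkseq (fun i => s`_i - (if (i < m)%N then 0 else s`_(i - m))) (size s).

Let coef_mul_one_subXn m p i : (p * (1 - 'X^m))`_i =
  p`_i - (if (i < m)%N then 0 else p`_(i - m)).
Proof. by rewrite mulrBr mulr1 coefB coefMXn. Qed.

Lemma truncationM m s p : truncation s p ->
  truncation (mul_one_subXn m s) (p * (1 - 'X^m)).
Proof.
move=> sp i; rewrite size_mkseq => si.
rewrite coef_mul_one_subXn nth_mkseq // sp // intrB.
by case: ltnP => [//|mi]; rewrite sp // (leq_ltn_trans (leq_subr _ _)).
Qed.

(* [1 - 'X^m] is invertible as a power series because [m] is positive. *)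
Lemma truncation_div m s p : (0 < m)%N ->
  truncation (mul_one_subXn m s) (p * (1 - 'X^m)) -> truncation s p.
Proof.
move=> m0 sp i; elim/ltn_ind: i => i IH si.
have := sp i; rewrite size_mkseq => /(_ si).
rewrite coef_mul_one_subXn nth_mkseq // intrB.
case: ltnP => [_|mi]; first by rewrite !subr0.
have im : (i - m < i)%N by rewrite ltn_subrL m0 (leq_trans m0 mi).
by rewrite (IH _ im (ltn_trans im si)) => /addIr.
Qed.

Let mul_seq s ms := foldl (fun t m => mul_one_subXn m t) s ms.

Lemma truncation_prod s p ms : truncation s p ->
  truncation (mul_seq s ms) (p * \prod_(m <- ms) (1 - 'X^m)).
Proof.
elim: ms s p => [|m ms IH] s p sp; first by rewrite big_nil mulr1.
by rewrite big_cons mulrA; apply/IH/truncationM.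
Qed.

(** A quotient is certified by multiplication: a candidate list is correct once its product with all
    the factors is. *)
Lemma truncation_div_prod s p ms : all (leq 1) ms ->
  truncation (mul_seq s ms) (p * \prod_(m <- ms) (1 - 'X^m)) ->
  truncation s p.
Proof.
elim: ms s p => [|m ms IH] s p /=; first by rewrite big_nil mulr1.
move=> /andP[m0 ms0]; rewrite big_cons mulrA => /(IH _ _ ms0).
exact: truncation_div.
Qed.

End truncated_coefficients.

(** * Fifth powers of the products, and the values of A *)

Lemma prod_flatten_nseq {K : comNzRingType} {I : Type} n (s : seq I) (F : I -> K) :
  \prod_(i <- flatten (nseq n s)) F i = (\prod_(i <- s) F i) ^+ n.
Proof.
by elim: n => [|n IH]; rewrite /= ?big_nil // big_cat IH exprS.
Qed.

(** Exponents of the factors 1 - X^m left modulo X^16, with multiplicity: (1, 4) gives the numerator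
    of R^5 and (2, 3) its denominator. *)
Definition rr_exponents b c : seq nat :=
  flatten (nseq 5 ([seq (b + 5 * k)%N | k <- iota 0 3] ++
                   [seq (c + 5 * k)%N | k <- iota 0 3])).

Lemma expands_qpochhammer5 {R : realType} b c : (0 < b)%N -> (0 < c)%N ->
  expands 16 (fun x : R =>
      (qpochhammer (x%:C ^+ b : Cplx R) (x%:C ^+ 5) *
       qpochhammer (x%:C ^+ c : Cplx R) (x%:C ^+ 5)) ^+ 5)
    (\prod_(m <- rr_exponents b c) (1 - 'X^m)).
Proof.
have expand d : (0 < d)%N -> expands 16
    (fun x : R => qpochhammer (x%:C ^+ d : Cplx R) (x%:C ^+ 5))
    (\prod_(k <- iota 0 3) (1 - 'X^(d + 5 * k))).
  by move=> d0; apply: (@expands_qpochhammer R d 5 isT 16 3); lia.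
move=> b0 c0; rewrite prod_flatten_nseq big_cat !big_map.
exact: expandsX (expandsM (expand b b0) (expand c c0)).
Qed.

Theorem theorem1p6 (R : realType) (A : nat -> Cplx R)
    (hA : forall q : Cplx R, `|q| < 1 ->
      series (fun n => A n * q ^+ n) @ \oo
        --> 1 / (rogers_ramanujan q) ^+ 5) :
  [/\ 0 < A 0%N, A 10%N < 0 & A 15%N < 0].
Proof.
pose P : {poly R[i]} := \poly_(i < 16) A i.
have LP : expands 16 (fun x => 1 / rogers_ramanujan (x%:C : Cplx R) ^+ 5) P.
  apply: expands_series => x /andP[x0 x1]; apply: hA.
  by rewrite (ger0_norm (realC_ge0 x0)) ltcR.
have coefN : forall i, (i < 16)%N ->
    (P * \prod_(m <- rr_exponents 1 4) (1 - 'X^m))`_i =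
    (\prod_(m <- rr_exponents 2 3) (1 - 'X^m))`_i.
  apply: (expands_uniq _ (expands_qpochhammer5 2 3 isT isT)).
  have [C [r [r0 Cr]]] := expandsM LP (expands_qpochhammer5 1 4 isT isT).
  (* Below 1/2 the numerator of R is nonzero, so it cancels in (1/R^5) D^5. *)
  exists C, (Num.min r 2^-1); split; first by rewrite lt_min r0 /= invr_gt0 ltr0n.
  move=> x /andP[x0]; rewrite lt_min => /andP[xr x2].
  have := Cr x; rewrite x0 xr => /(_ isT).
  have xh : 0 < x < 2^-1 by rewrite x0.
  have d1 := qpochhammer_neq0 1 5 isT isT xh.
  have d4 := qpochhammer_neq0 4 5 isT isT xh.
  rewrite /rogers_ramanujan -{1}[x%:C]expr1 div1r -exprVn invf_div -exprMn.
  by rewrite divfK // mulf_neq0.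
(* The claimed A(0), ..., A(15), to be checked by multiplying by D^5. *)
pose t : seq int :=
  [:: 1; 5; 10; 5; -15; -24; 15; 70; 30; -125; -175; 95; 420; 180; -615; -826].
have tP : truncation t P.
  apply: (@truncation_div_prod _ _ _ (rr_exponents 1 4)) => // i i16.
  rewrite coefN // -[\prod_(m <- rr_exponents 2 3) _]mul1r.
  (* N^5 is expanded from the series 1, and the two integer lists are compared by evaluation. *)
  rewrite (@truncation_prod _ (1%:Z :: nseq 15 0) 1).
  - by congr (_ %:~R); congr nth; vm_compute.
  - move=> [|k] _; rewrite coef1 // -[nth _ _ _]/((nseq 15 (0 : int))`_k).
    by rewrite nth_nseq if_same.
  - by [].
have At i : (i < 16)%N -> A i = (t`_i)%:~R.
  by move=> i16; rewrite -tP // coef_poly i16.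
by split; rewrite At // ?ltr0z ?ltrz0.
Qed.
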